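(* Let $A_0,A_1,\ldots,A_n$ be symmetric $m\times m$ matrices with entries in $\mathbb{Q}$, and let $A(x)=A_0+x_1A_1+\cdots+x_nA_n$. Let $\mathscr{S}=\{x\in\mathbb{R}^n : A(x)\succeq 0\}$ and suppose that $\mathscr{S}\neq\emptyset$. Let $r(A)=\min\{\operatorname{rank}A(x) : x\in\mathscr{S}\}$ and, for every integer $r$, let $\mathcal{D}_r=\{x\in\mathbb{C}^n : \operatorname{rank}A(x)\le r\}$. Let $\mathcal{C}$ be a connected component of $\mathcal{D}_{r(A)}\cap\mathbb{R}^n$ such that $\mathcal{C}\cap\mathscr{S}\neq\emptyset$. Then $\mathcal{C}\subset\mathscr{S}$, and hence $\mathcal{C}\subset(\mathcal{D}_{r(A)}\setminus\mathcal{D}_{r(A)-1})\cap\mathbb{R}^n$.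
   Context: $A(x)\succeq 0$ means that the real symmetric matrix $A(x)$ is positive semidefinite. Connected components are taken with respect to the Euclidean topology of $\mathbb{R}^n$. By convention $\mathcal{D}_{-1}=\emptyset$. *)

(* Defs.v *)
(* MathComp-Analysis: the real numbers are an arbitrary R : realType, and the
   complex numbers are R[i]. *)
From HB Require Import structures.
From mathcomp Require Import all_boot all_order all_algebra.
From mathcomp Require Import sesquilinear.
From mathcomp Require Import complex.
From mathcomp Require Import boolp classical_sets reals topology normedtype.

Set Implicit Arguments.
Unset Strict Implicit.
Unset Printing Implicit Defensive.

Import Order.TTheory GRing.Theory Num.Theory.
Import numFieldNormedType.Exports.

Local Open Scope classical_set_scope.
Local Open Scope ring_scope.

(* The coefficient A_i with i >= 1 is A (lift ord0 j), where i = j + 1. *)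
Definition pencil (F : numFieldType) (m n : nat)
    (A : 'I_n.+1 -> 'M[rat]_m) (x : 'rV[F]_n) : 'M[F]_m :=
  map_mx ratr (A ord0) + \sum_(j < n) x 0 j *: map_mx ratr (A (lift ord0 j)).

Definition psdmx (R : realType) (m : nat) (M : 'M[R]_m) : Prop :=
  M \is symmetricmx /\ forall v : 'cV[R]_m, 0 <= (v^T *m M *m v) 0 0.

Definition spectrahedron (R : realType) (m n : nat)
    (A : 'I_n.+1 -> 'M[rat]_m) : set 'rV[R]_n :=
  [set x | psdmx (pencil A x)].

Lemma exists_spectrahedron_rank (R : realType) (m n : nat)
    (A : 'I_n.+1 -> 'M[rat]_m) :
  @spectrahedron R m n A !=set0 ->
  exists r : nat,
    `[< exists2 x : 'rV[R]_n, spectrahedron A x & \rank (pencil A x) = r >].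
Proof. by move=> [x Sx]; exists (\rank (pencil A x)); apply/asboolP; exists x. Qed.

(* ex_minn takes a proof that the set of ranks it minimizes over is nonempty;
   its value does not depend on that proof. *)
Definition minrank (R : realType) (m n : nat) (A : 'I_n.+1 -> 'M[rat]_m)
    (S0 : @spectrahedron R m n A !=set0) : nat :=
  ex_minn (exists_spectrahedron_rank S0).

(* r is an integer, so that r = -1 is allowed; the locus is then empty. *)
Definition detlocus (R : realType) (m n : nat) (A : 'I_n.+1 -> 'M[rat]_m)
    (r : int) : set 'rV[R[i]]_n :=
  [set x | (\rank (pencil A x))%:Z <= r].

(* The intersection of a subset of C^n with R^n, as a subset of R^n. *)
Definition real_trace (R : realType) (n : nat) (X : set 'rV[R[i]]_n) :
    set 'rV[R]_n :=
  map_mx (real_complex R) @^-1` X.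

Definition is_component (T : topologicalType) (X C : set T) : Prop :=
  exists2 x, X x & C = connected_component X x.

(* Main.v *)
(* The set C `&` spectrahedron A is nonempty, closed and open in C, hence is all
   of the connected set C.  Openness is where the minimality of the rank enters:
   if M0 is positive semidefinite of rank k, there is an m x k matrix B with
   B^T M0 B = 1.  For M symmetric close to M0, P := B^T M B is still positive
   definite; if moreover rank M <= k, then B^T M has the same row space as M, so
   M = D (B^T M) for some D, and by symmetry M = D P D^T is again positive
   semidefinite. *)
Require Import Defs.
From HB Require Import structures.
From mathcomp Require Import all_boot all_order all_algebra.
From mathcomp Require Import sesquilinear.
From mathcomp Require Import complex.
From mathcomp Require Import boolp classical_sets reals topology normedtype.
From mathcomp Require Import ring lra zify.

Set Implicit Arguments.
Unset Strict Implicit.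
Unset Printing Implicit Defensive.

Import Order.TTheory GRing.Theory Num.Theory.
Import numFieldNormedType.Exports.

Local Open Scope classical_set_scope.
Local Open Scope ring_scope.

Lemma symmetricmxP (F : fieldType) (m : nat) (M : 'M[F]_m) :
  reflect (M^T = M) (M \is symmetricmx).
Proof.
rewrite is_hermitianmxE expr0 scale1r map_mx_id // eq_sym; exact: eqP.
Qed.

(** Polarization: the form at [e i + e j] is twice the entry [N i j], and 2 is invertible. *)
Lemma quadratic_form_eq0 (F : numFieldType) (m : nat) (N : 'M[F]_m) :
  N^T = N -> (forall v : 'cV_m, (v^T *m N *m v) 0 0 = 0) -> N = 0.
Proof.
move=> Ns N0; apply/matrixP => i j; rewrite [RHS]mxE.
pose e k : 'cV[F]_m := delta_mx k 0.
have Ee k l : ((e k)^T *m N *m e l) 0 0 = N k l.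
  by rewrite /e trmx_delta -rowE -colE !mxE.
have := N0 (e i + e j).
rewrite [(_ + _)^T]linearD /= !(mulmxDl, mulmxDr).
have mxD (X Y : 'M[F]_1) : (X + Y) 0 0 = X 0 0 + Y 0 0 by rewrite mxE.
rewrite !mxD !N0 add0r addr0 !Ee -[in N j i]Ns mxE -mulr2n => /eqP.
by rewrite mulrn_eq0 /= => /eqP.
Qed.

(** Gram-Schmidt for the possibly degenerate inner product given by [M], adding one column at a
    time. *)
Lemma psd_orthonormal_family (R : rcfType) (m k : nat) (M : 'M[R]_m) :
  M^T = M -> (forall v : 'cV_m, 0 <= (v^T *m M *m v) 0 0) ->
  (k <= \rank M)%N -> exists B : 'M_(m, k), B^T *m M *m B = 1%:M.
Proof.
move=> Ms M0; elim: k => [|k IHk] kM; first by exists 0; rewrite thinmx0 flatmx0.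
have [B BM] := IHk (ltnW kM).
(* The form of [N] at v is the form of [M] at the M-orthogonal projection of v away from the columns
   of [B]. *)
pose N := M - M *m B *m (B^T *m M).
have Ns : N^T = N.
  by rewrite /N linearB /= !trmx_mul trmxK Ms.
(* Otherwise M = M B B^T M would have rank at most k. *)
have [v Nv] : exists v : 'cV_m, (v^T *m N *m v) 0 0 != 0.
  apply: contrapT => /forallNP Nv.
  suff /subr0_eq MB : N = 0.
    move: kM; rewrite ltnNge MB => /negP; apply.
    by rewrite (leq_trans (mxrankM_maxl _ _)) // rank_leq_col.
  by apply: quadratic_form_eq0 => // v; have /negP/negPn/eqP := Nv v.
(* w is M-orthogonal to the columns of B. *)
pose w := v - B *m (B^T *m M *m v).
have Bw : B^T *m M *m w = 0.
  by rewrite /w mulmxBr [X in _ - X]mulmxA BM mul1mx subrr.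
have wB : w^T *m M *m B = 0.
  by apply: trmx_inj; rewrite !trmx_mul trmxK Ms mulmxA Bw trmx0.
have wN : w^T *m M *m w = v^T *m N *m v.
  rewrite {2}/w mulmxBr [X in _ - X]mulmxA wB mul0mx subr0 /w /N linearB /=.
  by rewrite !trmx_mul trmxK Ms !(mulmxBl, mulmxBr) !mulmxA.
set q := (w^T *m M *m w) 0 0.
have q0 : 0 < q by rewrite lt_neqAle M0 andbT /q wN eq_sym.
rewrite -(addn1 k); exists (row_mx B ((Num.sqrt q)^-1 *: w)).
rewrite tr_row_mx mul_col_mx mul_col_row BM [(_ *: w)^T]linearZ /=.
rewrite -!scalemxAr -!scalemxAl Bw wB !scaler0 scalerA scalar_mx_block; congr block_mx.
rewrite [w^T *m M *m w]mx11_scalar -/q scale_scalar_mx; congr (_%:M).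
by rewrite -invfM -expr2 sqr_sqrtr ?ltW // mulVf // gt_eqF.
Qed.

Lemma quadratic_formE (F : comNzRingType) (k : nat) (P : 'M[F]_k)
    (a : 'cV[F]_k) :
  (a^T *m P *m a) 0 0 = \sum_i \sum_j P i j * (a i 0 * a j 0).
Proof.
rewrite mxE exchange_big; apply: eq_bigr => j _ /=.
rewrite !mxE mulr_suml; apply: eq_bigr => i _.
by rewrite mxE mulrA [a i 0 * _]mulrC.
Qed.

(** The entrywise errors cost at most k/(k+1) of the squared norm of [a], so a positive share
    remains; using k+1 also covers k = 0. *)
Lemma near_identity_posdef (R : realFieldType) (k : nat) (P : 'M[R]_k)
    (a : 'cV[R]_k) :
  (forall i j, `|P i j - (1%:M : 'M_k) i j| <= k.+1%:R^-1) ->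
  k.+1%:R^-1 * \sum_i a i 0 ^+ 2 <= (a^T *m P *m a) 0 0.
Proof.
set e := k.+1%:R^-1; set S := \sum_i _ => Pe.
have -> : (a^T *m P *m a) 0 0 = S + (a^T *m (P - 1%:M) *m a) 0 0.
  rewrite (_ : a^T *m P *m a = a^T *m a + a^T *m (P - 1%:M) *m a); last first.
    by rewrite mulmxBr mulmxBl mulmx1 addrC subrK.
  rewrite mxE; congr (_ + _); rewrite mxE.
  by apply: eq_bigr => i _; rewrite mxE expr2.
have ek : e * k%:R = 1 - e.
  apply/eqP; rewrite eq_sym subr_eq -[X in _ == _ + X]mulr1 -mulrDr natr1.
  by rewrite mulVf // pnatr_eq0.
(* The terms of the form of P - 1 are bounded by AM-GM, and S - k e S = e S. *)
have -> : e * S = S + \sum_(i < k) \sum_(j < k)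
    - (e * ((a i 0 ^+ 2 + a j 0 ^+ 2) / 2)).
  under eq_bigr => i _.
    rewrite sumrN -mulr_sumr -mulr_suml big_split sumr_const card_ord /= -/S.
    over.
  rewrite sumrN -mulr_sumr -mulr_suml big_split sumr_const card_ord /=.
  rewrite sumrMnl -/S -[S *+ k]mulr_natr.
  by transitivity (S - (e * k%:R) * S); [rewrite ek; ring | field].
rewrite quadratic_formE lerD2l; apply: ler_sum => i _; apply: ler_sum => j _.
rewrite lerNl (le_trans (ler_norm _)) // normrN normrM.
apply: ler_pM => //; first by have := Pe i j; rewrite !mxE.
rewrite normrM -(real_normK (num_real (a i 0))).
rewrite -(real_normK (num_real (a j 0))).
by have := sqr_ge0 (`|a i 0| - `|a j 0|); lra.
Qed.

Lemma psd_of_rank_le (R : realFieldType) (m k : nat) (M : 'M[R]_m)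
    (B : 'M_(m, k)) :
  M^T = M -> (\rank M <= k)%N ->
  (forall i j, `|(B^T *m M *m B) i j - (1%:M : 'M_k) i j| <= k.+1%:R^-1) ->
  forall v : 'cV_m, 0 <= (v^T *m M *m v) 0 0.
Proof.
move=> Ms Mk PB v; set P := B^T *m M *m B in PB.
have e0 : 0 < k.+1%:R^-1 :> R by rewrite invr_gt0 ltr0n.
(* If [u *m P = 0], the form of [P] vanishes at [u^T], so the lower bound forces the sum of squares
   of [u] to be zero. *)
have Pfree : row_free P.
  apply: inj_row_free => u uP.
  have := near_identity_posdef u^T PB.
  rewrite trmxK uP mul0mx mxE pmulr_rle0 // => u0.
  apply/rowP => i; rewrite mxE; apply/eqP; rewrite -(sqrf_eq0 (u 0 i)).
  rewrite eq_le sqr_ge0 andbT (le_trans _ u0) // (bigD1 i) //= mxE lerDl.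
  by apply: sumr_ge0 => j _; exact: sqr_ge0.
(* Equality of row spaces by dimension: rank M <= k = rank P <= rank (B^T M). *)
have /submxP[D MD] : (M <= B^T *m M)%MS.
  have BM : (B^T *m M <= M)%MS by rewrite submxMl.
  rewrite -(geq_leqif (mxrank_leqif_sup BM)) (leq_trans Mk) //.
  by rewrite -{1}(eqP Pfree) /P mxrankM_maxl.
have -> : M = D *m P *m D^T.
  by rewrite {1}MD -{1}Ms {1}MD !trmx_mul trmxK Ms /P !mulmxA.
have := near_identity_posdef (D^T *m v) PB.
rewrite trmx_mul trmxK !mulmxA; apply: le_trans.
apply: mulr_ge0; first exact: ltW.
by apply: sumr_ge0 => i _; exact: sqr_ge0.
Qed.

Lemma pencil_sym (F : numFieldType) (m n : nat) (A : 'I_n.+1 -> 'M[rat]_m)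
    (x : 'rV[F]_n) :
  (forall i, A i \is symmetricmx) -> (pencil A x)^T = pencil A x.
Proof.
move=> As; have AT i : (map_mx ratr (A i))^T = map_mx ratr (A i) :> 'M[F]_m.
  by rewrite map_trmx (symmetricmxP _ (As i)).
rewrite /pencil linearD linear_sum /= AT; congr (_ + _).
by apply: eq_bigr => j _; rewrite linearZ /= AT.
Qed.

(** Rank is unchanged by field extension, so on real points the complex determinantal locus is a
    condition on the real pencil. *)
Lemma rank_pencil_complex (R : realType) (m n : nat)
    (A : 'I_n.+1 -> 'M[rat]_m) (x : 'rV[R]_n) :
  \rank (pencil A (map_mx (real_complex R) x)) = \rank (pencil A x).
Proof.
rewrite -(mxrank_map (real_complex R)); congr (\rank _).
have AR i : map_mx (real_complex R) (map_mx ratr (A i)) = map_mx ratr (A i).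
  by rewrite -map_mx_comp; apply: eq_map_mx => q /=; rewrite fmorph_rat.
rewrite /pencil map_mxD AR map_mx_sum; congr (_ + _).
by apply: eq_bigr => j _; rewrite map_mxZ AR mxE.
Qed.

(** Such an entry is affine in x. The factors [U] and [V] let one statement serve both the quadratic
    forms at a fixed vector and the matrix B^T A(x) B. *)
Lemma pencil_entry_continuous (R : realType) (m n p q : nat)
    (A : 'I_n.+1 -> 'M[rat]_m) (U : 'M[R]_(p, m)) (V : 'M[R]_(m, q)) i j :
  continuous (fun x : 'rV[R]_n => (U *m pencil A x *m V) i j).
Proof.
have -> : (fun x : 'rV[R]_n => (U *m pencil A x *m V) i j) =
    fun x => (U *m map_mx ratr (A ord0) *m V) i j +
      \sum_(l < n) x 0 l * (U *m map_mx ratr (A (lift ord0 l)) *m V) i j.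
  apply/funext => x; rewrite /pencil mulmxDr mulmxDl mxE; congr (_ + _).
  rewrite mulmx_sumr mulmx_suml summxE; apply: eq_bigr => l _.
  by rewrite -scalemxAr -scalemxAl mxE.
move=> x; apply: continuousD; first exact: cst_continuous.
move: x; apply: continuous_big => [|l _ x]; first exact: add_continuous.
apply: continuousM; [exact: coord_continuous | exact: cst_continuous].
Qed.

Lemma closed_spectrahedron (R : realType) (m n : nat)
    (A : 'I_n.+1 -> 'M[rat]_m) :
  (forall i, A i \is symmetricmx) -> closed (@spectrahedron R m n A).
Proof.
move=> As.
have -> : @spectrahedron R m n A = \bigcap_(v in [set: 'cV[R]_m])
    ((fun x => (v^T *m pencil A x *m v) 0 0) @^-1` [set y | 0 <= y]).
  apply/seteqP; split => x Ax; first by move=> v _; exact: Ax.2.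
  by split=> [|v]; [exact/symmetricmxP/pencil_sym | exact: Ax].
apply: closed_bigI => v _; apply: preimage_closed; last exact: closed_ge.
by move=> x _; exact: pencil_entry_continuous.
Qed.

Lemma near_spectrahedron (R : realType) (m n : nat) (A : 'I_n.+1 -> 'M[rat]_m)
    (x0 : 'rV[R]_n) :
  (forall i, A i \is symmetricmx) -> spectrahedron A x0 ->
  \forall x \near x0, (\rank (pencil A x) <= \rank (pencil A x0))%N ->
    spectrahedron A x.
Proof.
move=> As [_ Ax0].
have [B BA] := psd_orthonormal_family (pencil_sym x0 As) Ax0 (leqnn _).
set k := \rank _ in B BA *.
have e0 : 0 < k.+1%:R^-1 :> R by rewrite invr_gt0 ltr0n.
(* [B] stays fixed while x varies; B^T A(x) B is continuous in x and equals 1 at [x0]. *)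
have nearB : \forall x \near x0, forall i j,
    `|(B^T *m pencil A x *m B) i j - (1%:M : 'M_k) i j| <= k.+1%:R^-1.
  apply: (filter_forall (nbhs_filter x0)) => i.
  apply: (filter_forall (nbhs_filter x0)) => j.
  have := @pencil_entry_continuous R m n k k A B^T B i j x0.
  move=> /cvgrPdist_le/(_ _ e0); apply: filterS => x.
  by rewrite BA distrC.
apply: filterS nearB => x nearB rx; split; first exact/symmetricmxP/pencil_sym.
exact: (psd_of_rank_le (pencil_sym x As) rx).
Qed.

Theorem theorem2 (R : realType) (m n : nat) (A : 'I_n.+1 -> 'M[rat]_m)
    (A_sym : forall i, A i \is symmetricmx)
    (S0 : @spectrahedron R m n A !=set0)
    (C : set 'rV[R]_n)
    (C_comp : is_component (real_trace (detlocus A (minrank S0)%:Z)) C)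
    (CS : C `&` spectrahedron A !=set0) :
  C `<=` spectrahedron A /\
  C `<=` real_trace
    (detlocus A (minrank S0)%:Z `\` detlocus A ((minrank S0)%:Z - 1)).
Proof.
have [x0 _ Cx0] := C_comp.
have rk x : C x -> (\rank (pencil A x) <= minrank S0)%N.
  rewrite Cx0 => /connected_component_sub.
  by rewrite /real_trace /detlocus /= rank_pencil_complex lez_nat.
have minr (x : 'rV[R]_n) :
    spectrahedron A x -> (minrank S0 <= \rank (pencil A x))%N.
  move=> Sx; rewrite /minrank; case: ex_minnP => r _; apply.
  by apply/asboolP; exists x.
have CSC : C `&` spectrahedron A = C.
  (* The spectrahedron need not be open in the ambient space; the interior of this implication is an
     open set with the same trace on [C]. *)
  pose U := [set x | C x -> spectrahedron A x]°.
  rewrite {2}Cx0; apply: component_connected => //; rewrite -Cx0.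
    exists U; first exact: open_interior.
    apply/seteqP; split => x [Cx]; last first.
      by move=> /interior_subset/(_ Cx).
    (* For y in [C], rank A(y) <= [minrank S0] <= rank A(x), which is the rank bound required near
       x. *)
    move=> Sx; split => //; move: (near_spectrahedron A_sym Sx).
    apply: filterS => y + Cy; apply.
    exact: leq_trans (rk _ Cy) (minr _ Sx).
  by exists (spectrahedron A) => //; exact: closed_spectrahedron.
have CsubS : C `<=` spectrahedron A by move=> x; rewrite -{1}CSC => -[].
split=> // x Cx.
rewrite /real_trace /detlocus /= rank_pencil_complex; split.
  by rewrite lez_nat rk.
by apply/negP; rewrite -ltNge; have := minr _ (CsubS _ Cx); lia.
Qed.
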